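(* Let $f:\mathbb{N}\to\mathbb{R}$ be defined by \[ f(d)=\begin{cases}1 & \text{if } d=0,\\ \frac56 & \text{if } d=1,\\ \frac{2}{d+1} & \text{if } d\geq 2.\end{cases} \] Then every graph $G$ has an induced linear forest with at least $\sum_{v\in V(G)} f(d_G(v))$ vertices.
   Context: All graphs are finite, simple, and undirected; $d_G(v)$ denotes the degree of vertex $v$ in $G$; $\mathbb{N}$ includes $0$. A forest is linear if every connected component of it is a path, where a single vertex is considered to be a path. An induced linear forest of $G$ is an induced subgraph of $G$ that is a linear forest. *)

(* Defs.v *)
From mathcomp Require Import all_boot all_order all_algebra.
From mathcomp Require Import reals.

Set Implicit Arguments.
Unset Strict Implicit.
Unset Printing Implicit Defensive.

Import Order.TTheory GRing.Theory Num.Theory.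

Record sgraph := SGraph {
  vertex :> finType;
  adj : rel vertex;
  adj_sym : symmetric adj;
  adj_irrefl : irreflexive adj
}.

Definition degree (G : sgraph) (v : G) : nat := #|[set w | adj v w]|.

Section Induced.
Variables (G : sgraph) (S : {set G}).

Definition induced_adj : rel {x : G | x \in S} :=
  fun x y => adj (val x) (val y).

Fact induced_adj_sym : symmetric induced_adj.
Proof. by move=> x y; apply: adj_sym. Qed.

Fact induced_adj_irrefl : irreflexive induced_adj.
Proof. by move=> x; apply: adj_irrefl. Qed.

Definition induced : sgraph := SGraph induced_adj_sym induced_adj_irrefl.
End Induced.

Definition component (G : sgraph) (x : G) : sgraph :=
  induced [set y | connect (@adj G) x y].

Definition isomorphic (G H : sgraph) : Prop :=
  exists2 h : G -> H, bijective h & {mono h : x y / adj x y}.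

Section PathGraph.
Variable n : nat.

Definition path_adj : rel 'I_n :=
  fun i j => (j == i.+1 :> nat) || (i == j.+1 :> nat).

Fact path_adj_sym : symmetric path_adj.
Proof. by move=> i j; rewrite /path_adj orbC. Qed.

Fact path_adj_irrefl : irreflexive path_adj.
Proof. by move=> i; rewrite /path_adj orbb ltn_eqF. Qed.

Definition path_graph : sgraph := SGraph path_adj_sym path_adj_irrefl.
End PathGraph.

(* A single vertex is a path (n = 1); the null graph is not. *)
Definition is_path (G : sgraph) : Prop :=
  exists2 n : nat, 0 < n & isomorphic (path_graph n) G.

(* The bound on size excludes the ucycles [::] and [:: x; y], which are not
   cycles of a simple graph. *)
Definition is_forest (G : sgraph) : Prop :=
  forall c : seq G, 3 <= size c -> ~ ucycle (@adj G) c.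

Definition is_linear_forest (G : sgraph) : Prop :=
  is_forest G /\ forall x : G, is_path (component x).

Local Open Scope ring_scope.

Definition f (R : realType) (d : nat) : R :=
  match d with
  | 0 => 1
  | 1 => 5 / 6
  | _ => 2 / d.+1%:R
  end.

(* Main.v *)
Require Import Defs.
From mathcomp Require Import all_boot all_order all_algebra.
From mathcomp Require Import boolp reals ring lra zify.

Set Implicit Arguments.
Unset Strict Implicit.
Unset Printing Implicit Defensive.

Import Order.TTheory GRing.Theory Num.Theory.

(** The bound is proved by induction on a vertex set [S], for the weight
    [w(S)], the sum of [f (deg v)] over [S] with degrees taken in the subgraph
    induced by [S].  The function [f] is convex with decrements
    [1/6, 1/6, 1/6, 1/10, ...], the decrement from [d - 1] to [d] being
    [2 / (d (d + 1))] as soon as [d >= 3].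

    If the maximum degree [D] is at least 3, delete a vertex [x] of degree [D].
    Each of its [D] neighbours has degree at most [D], so by convexity its
    contribution rises by at least [2 / (D (D + 1))]; together they make up for
    the loss of [f D = 2 / (D + 1)], and the weight does not drop
    ([weight_delete_max]).

    If the maximum degree is at most 2 and there is a cycle [C], then [C] is a
    whole component ([cycle_closed]) and weighs [2/3 |C| <= |C| - 1] because
    [|C| >= 3] ([weight_delete_cycle]).  So the induction is applied to
    [S] without [C], and all but one vertex of [C] are added to its result.

    If there is no cycle either, [S] itself is kept, since [f <= 1].  It induces
    a linear forest: in a forest of maximum degree 2, a longest simple path
    through a vertex exhausts the component of that vertex
    ([longest_path_closed]) and has no chord ([forest_simple_path_induced]). *)

(** * Degrees and cycles in a vertex set *)

Definition degree_in (G : sgraph) (S : {set G}) (v : G) : nat :=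
  #|[set w in S | adj v w]|.

Lemma size_leq_degree_in (G : sgraph) (S : {set G}) (v : G) (s : seq G) :
  uniq s -> {subset s <= S} -> all (adj v) s -> size s <= degree_in S v.
Proof.
move=> Us sS /allP adj_s; rewrite -(card_uniqP Us).
by apply: subset_leq_card; apply/subsetP => w ws; rewrite inE sS //= adj_s.
Qed.

Lemma degree_in_setT (G : sgraph) (v : G) : degree_in [set: G] v = degree v.
Proof. by apply: eq_card => w; rewrite !inE. Qed.

Lemma degree_in_subset (G : sgraph) (S T : {set G}) (v : G) :
  T \subset S -> degree_in T v <= degree_in S v.
Proof.
move=> /subsetP TS; apply: subset_leq_card; apply/subsetP => w.
by rewrite !inE => /andP[/TS-> ->].
Qed.

Lemma degree_induced (G : sgraph) (S : {set G}) (v : induced S) :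
  degree v = degree_in S (val v).
Proof.
rewrite /degree -(card_imset _ val_inj); apply: eq_card => w.
apply/imsetP/idP => [[u]|]; first by rewrite !inE => vu ->; rewrite (valP u).
by rewrite inE => /andP[Sw vw]; exists (Sub w Sw); rewrite ?SubK // inE.
Qed.

(** Acyclicity of the subgraph induced by [S], phrased with cycles of [G] so
    that different vertex sets can be compared without transporting cycles
    between subtypes. *)
Definition acyclic_on (G : sgraph) (S : {set G}) : Prop :=
  forall c : seq G, {subset c <= S} -> 3 <= size c -> ~ ucycle (@adj G) c.

Lemma induced_forest (G : sgraph) (S : {set G}) :
  acyclic_on S -> is_forest (induced S).
Proof.
move=> acS c szc /andP[cyc Uc]; apply: (acS (map val c)).
- by move=> _ /mapP[u _ ->]; apply: valP.
- by rewrite size_map.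
by rewrite /ucycle (map_inj_uniq val_inj) Uc cycle_map andbT.
Qed.

(** * Components of forests of maximum degree two *)

Section PathComponents.
Variable H : sgraph.

(** A chord between positions [i] and [j >= i + 2] would close the segment of
    the path from [i] to [j] into a cycle. *)
Lemma forest_simple_path_induced (p : seq H) (x0 : H) (i j : nat) :
    is_forest H -> uniq p -> sorted (@adj H) p -> i < j < size p ->
  adj (nth x0 p i) (nth x0 p j) -> j = i.+1.
Proof.
move=> forestH Up Sp /andP[lt_ij lt_jp] adj_ij.
have [//|nij] := eqVneq j i.+1.
pose c := take (j - i).+1 (drop i p).
have szc : size c = (j - i).+1.
  by rewrite size_takel // size_drop; lia.
have nthc k : k <= j - i -> nth x0 c k = nth x0 p (i + k).
  by move=> le_k; rewrite nth_take // nth_drop.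
case: (@forestH c); first by rewrite szc; lia.
apply/andP; split; last by rewrite take_uniq // drop_uniq.
have Sc : sorted (@adj H) c by rewrite take_sorted // drop_sorted.
have head_c := nthc 0 (leq0n _); have last_c := nthc (j - i) (leqnn _).
rewrite addn0 in head_c; rewrite subnKC 1?ltnW // in last_c.
rewrite -head_c -last_c in adj_ij.
case: c szc Sc adj_ij {nthc head_c last_c} => [//|a c] /= [szc] pc.
rewrite -szc -[size c]/((size (a :: c)).-1) nth_last /= => adj_ij.
by rewrite rcons_path pc adj_sym.
Qed.

Definition simple_path (p : seq H) := uniq p && sorted (@adj H) p.

Lemma longest_simple_path (x : H) :
  exists2 p : seq H, simple_path p && (x \in p) &
    forall q, simple_path q && (x \in q) -> size q <= size p.
Proof.
pose P n := [exists p : n.-tuple H, simple_path p && (x \in p)].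
have exP : exists n, P n.
  exists 1; apply/existsP; exists [tuple x].
  by rewrite /simple_path /= mem_head.
have ubP n : P n -> n <= #|H|.
  case/existsP=> p /andP[/andP[Up _] _].
  by rewrite -{1}(size_tuple p) -(card_uniqP Up) max_card.
case: (ex_maxnP exP ubP) => n /existsP[p Pp] max_n.
exists p => // q Pq; rewrite size_tuple; apply: max_n.
by apply/existsP; exists (in_tuple q).
Qed.

(** A neighbour [z] of [y] outside the path would extend the path if [y] is one
    of its ends, and would be a third neighbour of [y] otherwise. *)
Lemma longest_path_closed (x : H) (p : seq H) (y z : H) :
    (forall v : H, degree v <= 2) -> simple_path p && (x \in p) ->
    (forall q, simple_path q && (x \in q) -> size q <= size p) ->
  y \in p -> adj y z -> z \in p.
Proof.
move=> deg2 /andP[/andP[Up Sp] xp] max_p yp yz; apply/negPn/negP => zp.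
case/splitPr: yp Up Sp xp max_p zp => p1 p2.
case/lastP: p1 => [|p1 a] Up Sp xp max_p zp.
  (* [y] is the first vertex: prepend [z]. *)
  suff: size [:: z, y & p2] <= size (y :: p2) by rewrite /= ltnn.
  apply: max_p; rewrite /simple_path cons_uniq zp Up /=.
  by rewrite adj_sym yz in_cons xp orbT andbT.
case: p2 => [|b p2] in Up Sp xp max_p zp.
  (* [y] is the last vertex: append [z]. *)
  move: {p1 a}(rcons p1 a) Up Sp xp max_p zp => q.
  rewrite cats1 => Up Sp xp max_p zp.
  suff: size (rcons (rcons q y) z) <= size (rcons q y).
    by rewrite size_rcons ltnn.
  apply: max_p; rewrite /simple_path rcons_uniq zp Up mem_rcons in_cons xp orbT.
  rewrite andbT /=; case: {Up xp zp} q Sp => [|c q] /=.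
    by rewrite yz.
  by rewrite [path _ _ (rcons (rcons _ _) _)]rcons_path last_rcons yz andbT.
have ya : adj y a.
  move: Sp; rewrite cat_rcons; case: {Up xp max_p zp} p1 => [|c p1] /=.
    by rewrite adj_sym => /andP[].
  by rewrite cat_path /= [adj a y]adj_sym => /and4P[].
have yb : adj y b.
  move: Sp; case: {Up xp max_p zp ya} p1 => [|c p1] /=; first by case/and3P.
  by rewrite cat_path /= => /and4P[].
suff: 3 <= degree y by rewrite ltnNge deg2.
rewrite -degree_in_setT; apply: (@size_leq_degree_in _ _ _ [:: a; b; z]).
- move: Up zp; rewrite cat_uniq /= !mem_cat !mem_rcons !inE !negb_or.
  case/and3P=> _ /and3P[_ /andP[ba _] _] _ /andP[/andP[za _] /and3P[_ zb _]].
  by rewrite [a == b]eq_sym ba [a == z]eq_sym za [b == z]eq_sym zb.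
- by move=> w _; rewrite inE.
by rewrite /= ya yb yz.
Qed.

(** The isomorphism sends a position to the vertex there on a longest simple
    path through [x]; this path covers the component because it is closed under
    adjacency. *)
Lemma component_is_path (x : H) :
  is_forest H -> (forall v : H, degree v <= 2) -> is_path (component x).
Proof.
move=> forestH deg2; have [p Pp max_p] := longest_simple_path x.
have closed_p := longest_path_closed deg2 Pp max_p.
have /andP[/andP[Up Sp] xp] := Pp.
have nth_adj i : i.+1 < size p -> adj (nth x p i) (nth x p i.+1).
  by move=> lt_ip; apply: (sortedP x Sp).
have conn_p y : (connect (@adj H) x y) = (y \in p).
  apply/idP/idP => [/connectP[q]|].
    elim: q x xp {Pp max_p nth_adj} => [|z q IHq] w wp /=; first by move=> _ ->.
    by case/andP=> wz; apply: IHq; apply: closed_p wz.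
  move=> yp.
  have conn0 z : z \in p -> connect (@adj H) (nth x p 0) z.
    move=> zp; rewrite -(nth_index x zp).
    have : index z p < size p by rewrite index_mem.
    elim: (index z p) => [|i IHi] lt_ip; first exact: connect0.
    by apply: connect_trans (IHi (ltnW lt_ip)) (connect1 (nth_adj _ lt_ip)).
  apply: connect_trans (conn0 y yp).
  by rewrite (sym_connect_sym (@adj_sym H)) conn0.
exists (size p); first by case: (p) xp.
have in_comp (i : 'I_(size p)) : nth x p i \in [set y | connect (@adj H) x y].
  by rewrite inE conn_p mem_nth.
have lt_index (u : component x) : index (val u) p < size p.
  by rewrite index_mem -conn_p; have := valP u; rewrite inE.
exists (fun i : path_graph (size p) =>
          Sub (nth x p i) (in_comp i) : component x).
  exists (fun u => Ordinal (lt_index u)) => [i|u]; apply: val_inj => /=.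
    by rewrite index_uniq.
  by rewrite nth_index // -index_mem lt_index.
move=> i j; rewrite /= /induced_adj !SubK /path_adj; apply/idP/orP; last first.
  by case=> /eqP Eij; [|rewrite adj_sym]; rewrite Eij nth_adj // -Eij.
case: (ltngtP i j) => [lt_ij|lt_ji|/val_inj->]; last by rewrite adj_irrefl.
  move=> /(forest_simple_path_induced forestH Up Sp) Eij.
  by left; rewrite Eij ?eqxx ?lt_ij /=.
rewrite adj_sym => /(forest_simple_path_induced forestH Up Sp) Eji.
by right; rewrite Eji ?eqxx ?lt_ji /=.
Qed.

End PathComponents.

Lemma induced_linear_forest (G : sgraph) (S : {set G}) :
    acyclic_on S -> {in S, forall v, degree_in S v <= 2} ->
  is_linear_forest (induced S).
Proof.
move=> /induced_forest forestS deg2; split=> // x.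
apply: component_is_path => // v.
by rewrite degree_induced deg2 //; apply: valP.
Qed.

(** * Cycles in a vertex set of maximum degree two *)

Section Cycles.
Variables (G : sgraph) (S : {set G}).
Hypothesis deg2 : {in S, forall v, degree_in S v <= 2}.

Lemma cycle_neighbours (c : seq G) (y : G) :
    ucycle (@adj G) c -> 3 <= size c -> y \in c ->
  exists a b, [/\ a \in c, b \in c, adj y a, adj y b & a != b].
Proof.
case/andP=> cyc Uc szc yc; case: (rot_to yc) => i s rot_c.
have mem_c w : (w \in c) = (w \in y :: s) by rewrite -rot_c mem_rot.
move: cyc Uc szc; rewrite -(rot_cycle i) -(rot_uniq i) -(size_rot i) rot_c.
case: s => [|a s] // in rot_c mem_c *.
case/lastP: s => [|s b] // in rot_c mem_c *.
rewrite (cycle_path y) /= last_rcons => /and3P[by_ ya _].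
case/andP=> _ /andP[ab _] _.
exists a, b; rewrite !mem_c !(inE, mem_rcons) !eqxx !orbT ya adj_sym by_.
by split=> //; apply: contraNneq ab => ->; rewrite mem_rcons mem_head.
Qed.

(** The two neighbours on the cycle already use up the degree bound, so no
    edge of the induced subgraph leaves the cycle. *)
Lemma cycle_closed (c : seq G) (y z : G) :
    ucycle (@adj G) c -> 3 <= size c -> {subset c <= S} ->
  y \in c -> z \in S -> adj y z -> z \in c.
Proof.
move=> cyc szc cS yc zS yz; apply/negPn/negP => zc.
have [a [b [ac bc ya yb ab]]] := cycle_neighbours cyc szc yc.
suff: 3 <= degree_in S y by rewrite ltnNge deg2 // cS.
apply: (@size_leq_degree_in _ _ _ [:: a; b; z]) => /=.
- rewrite !inE (negbTE ab) /= andbT.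
  by apply/andP; split; apply: contraNneq zc => <-.
- by move=> w; rewrite !inE => /or3P[] /eqP-> //; apply: cS.
by rewrite ya yb yz.
Qed.

Lemma cycle_vertex_degree (c : seq G) (y : G) :
    ucycle (@adj G) c -> 3 <= size c -> {subset c <= S} -> y \in c ->
  degree_in S y = 2.
Proof.
move=> cyc szc cS yc; apply/eqP; rewrite eqn_leq deg2 ?cS //=.
have [a [b [ac bc ya yb ab]]] := cycle_neighbours cyc szc yc.
apply: (@size_leq_degree_in _ _ _ [:: a; b]) => /=; rewrite ?inE ?ab ?ya ?yb //.
by move=> w; rewrite !inE => /orP[] /eqP->; apply: cS.
Qed.

Lemma meeting_cycle_subset (c c' : seq G) (y : G) :
    ucycle (@adj G) c -> 3 <= size c -> {subset c <= S} ->
    cycle (@adj G) c' -> {subset c' <= S} ->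
  y \in c -> y \in c' -> {subset c' <= c}.
Proof.
move=> cyc szc cS cyc' c'S yc yc'; case: (rot_to yc') => i s rot_c'.
have sS : {subset rcons s y <= S}.
  move=> w; rewrite mem_rcons -rot_c' mem_rot; exact: c'S.
move: cyc'; rewrite -(rot_cycle i) rot_c' /= => path_s.
suff sc : {subset rcons s y <= c}.
  by move=> w; rewrite -(mem_rot i) rot_c' -mem_rcons; apply: sc.
move: (rcons s y) sS path_s {rot_c' yc'} => t.
elim: t y yc => [|z t IHt] v vc tS //=.
case/andP=> vz path_t.
have zc : z \in c.
  by apply: (cycle_closed cyc szc cS vc) vz; apply: tS; rewrite mem_head.
have tc : {subset t <= c}.
  by apply: IHt zc _ path_t => w wt; apply: tS; rewrite in_cons wt orbT.
by move=> w; rewrite in_cons => /predU1P[-> //|/tc].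
Qed.

(** A cycle [c'] in the union that meets [c] would contain all of [c] by
    [meeting_cycle_subset], hence the missing vertex [x]; a cycle that avoids
    [c] lies in [T]. *)
Lemma acyclic_break_cycle (c : seq G) (x : G) (T : {set G}) :
    ucycle (@adj G) c -> 3 <= size c -> {subset c <= S} -> x \in c ->
    T \subset S :\: [set v in c] -> acyclic_on T ->
  acyclic_on (T :|: ([set v in c] :\ x)).
Proof.
move=> cyc szc cS xc /subsetP TS acT c' c'T szc' cyc'.
have c'S : {subset c' <= S}.
  move=> w /c'T; rewrite !inE => /orP[/TS|/andP[_ /cS //]].
  by rewrite !inE => /andP[].
have [/hasP[y yc' yc]|/hasPn disj] := boolP (has (mem c) c').
  have xc' : x \in c'.
    have /andP[cyc_c _] := cyc.
    exact: (meeting_cycle_subset cyc' szc' c'S cyc_c cS yc' yc).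
  move: (c'T x xc'); rewrite !inE eqxx /= orbF => /TS.
  by rewrite !inE xc.
apply: acT szc' cyc' => w wc'.
by move: (c'T w wc') (disj w wc'); rewrite !inE => /orP[// | /andP[_ ->]].
Qed.

End Cycles.

(** * The degree weight *)

Local Open Scope ring_scope.

Section Weight.
Variable R : realType.

Definition weight (G : sgraph) (S : {set G}) : R :=
  \sum_(v in S) f R (degree_in S v).

Lemma f_leq1 (d : nat) : f R d <= 1.
Proof.
case: d => [|[|d]] //=; first by lra.
by rewrite ler_pdivrMr ?ltr0n // mul1r ler_nat.
Qed.

(** Convexity of [f]: [2 / (D (D + 1))] is the decrement of [f] from [D - 1] to
    [D], and earlier decrements are no smaller.  The first three decrements
    equal [1/6], the value of that expression at [D = 3]; this is where the
    constant [5/6] matters. *)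
Lemma f_drop (d D : nat) : (3 <= D)%N -> (d < D)%N ->
  f R d.+1 + 2 / (D%:R * D.+1%:R) <= f R d.
Proof.
move=> D3 dD; have D3R : 3 <= D%:R :> R by rewrite (ler_nat R 3).
have [d2|d2] := ltnP d 2.
  have bound : 2 / (D%:R * D.+1%:R) <= 1 / 6 :> R.
    rewrite -(natr1 D) ler_pdivrMr; last by apply: mulr_gt0; lra.
    have : 3 * 4 <= D%:R * (D%:R + 1) :> R by apply: ler_pM; lra.
    by lra.
  move: (2 / _) bound => t t_le.
  by case: d d2 {dD} => [|[|d]] //= _; lra.
have dDR : d.+1%:R <= D%:R :> R by rewrite ler_nat.
have d0 : 0 < d.+1%:R :> R by rewrite ltr0n.
have -> : f R d = 2 / d.+1%:R by case: d d2 {dD dDR d0} => [|[|]].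
have -> : f R d.+1 = 2 / d.+2%:R by case: d d2 {dD dDR d0} => [|[|]].
have -> : 2 / d.+1%:R = 2 / d.+2%:R + 2 / (d.+1%:R * d.+2%:R) :> R.
  by rewrite -(natr1 d.+1); field; lra.
rewrite lerD2l ler_pM2l ?lef_pV2 ?posrE ?mulr_gt0 ?ltr0n //.
  by rewrite ler_pM // ler_nat.
exact: leq_ltn_trans dD.
Qed.

(** The loss [f D] is split into [D] equal gains, one for each neighbour of
    [x], and each gain is covered by [f_drop]. *)
Lemma weight_delete_max (G : sgraph) (S : {set G}) (x : G) :
    x \in S -> (3 <= degree_in S x)%N ->
    {in S, forall v, degree_in S v <= degree_in S x}%N ->
  weight S <= weight (S :\ x).
Proof.
move=> xS; set D := degree_in S x => D3 max_x.
have D0 : 0 < D%:R :> R by rewrite ltr0n; apply: leq_trans D3.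
pose gain : R := 2 / (D%:R * D.+1%:R).
have drop v : v \in S :\ x ->
    f R (degree_in S v) + (if adj x v then gain else 0) <=
    f R (degree_in (S :\ x) v).
  rewrite !inE => /andP[vx vS].
  have deg_v : degree_in S v = (adj x v + degree_in (S :\ x) v)%N.
    rewrite /degree_in (cardsD1 x) !inE xS adj_sym; congr (_ + _)%N.
    by apply: eq_card => w; rewrite !inE andbA.
  have := max_x v vS; rewrite deg_v.
  case: (adj x v) => [|_] /=; last by rewrite addr0.
  by rewrite add1n; apply: f_drop.
rewrite /weight (big_setD1 x) //= -/D.
have -> : f R D = \sum_(v in S :\ x) (if adj x v then gain else 0).
  rewrite -big_mkcondr /= sumr_const.
  have -> : #|[pred v in S :\ x | adj x v]| = D.
    apply: eq_card => w; rewrite !inE; have [->|//] := eqVneq w x.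
    by rewrite adj_irrefl !andbF.
  rewrite /gain -mulr_natr; case: D D3 D0 {gain max_x drop} => [|[|D]] //= _ D0.
  by field; rewrite -!natr1; lra.
by rewrite addrC -big_split /=; apply: ler_sum.
Qed.

(** The degrees outside the cycle do not change since [cycle_closed] leaves no
    edge to the cycle; on the cycle every vertex weighs [f 2 = 2/3], and
    [2/3 n <= n - 1] for [n >= 3]. *)
Lemma weight_delete_cycle (G : sgraph) (S : {set G}) (c : seq G) :
    {in S, forall v, degree_in S v <= 2}%N ->
    ucycle (@adj G) c -> (3 <= size c)%N -> {subset c <= S} ->
  weight S <= weight (S :\: [set v in c]) + (size c).-1%:R.
Proof.
move=> deg2 cyc szc cS; rewrite /weight (big_setID [set v in c]) /= addrC.
apply: lerD.
  rewrite le_eqVlt; apply/orP; left; apply/eqP; apply: eq_bigr => v.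
  rewrite !inE => /andP[vc vS]; congr f; apply: eq_card => w; rewrite !inE.
  case vw: (adj v w); rewrite ?andbF ?andbT //.
  case wS: (w \in S); rewrite ?andbF ?andbT //; apply/esym.
  apply: contra vc => wc; apply: (cycle_closed deg2 cyc szc cS wc) => //.
  by rewrite adj_sym.
have -> : S :&: [set v in c] = [set v in c].
  by apply/setIidPr/subsetP => v; rewrite inE => /cS.
rewrite (eq_bigr (fun=> 2 / 3)) => [|v]; last first.
  by rewrite inE => vc; rewrite (cycle_vertex_degree deg2 cyc).
have Uc : uniq c by case/andP: cyc.
rewrite sumr_const cardsE (card_uniqP Uc) -mulr_natl.
case: (size c) szc => // n n2; rewrite /= -natr1.
have : 2 <= n%:R :> R by rewrite (ler_nat R 2).
by lra.
Qed.

(** Degree bound and acyclicity are the two conditions that can be tested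
    inside [G] and suffice for a linear forest by [induced_linear_forest]. *)
Lemma large_linear_forest_set (G : sgraph) (S : {set G}) :
  exists T : {set G},
    [/\ T \subset S, acyclic_on T, {in T, forall v, degree_in T v <= 2}%N
      & weight S <= #|T|%:R].
Proof.
have [n leSn] := ubnP #|S|; elim: n => // n IHn in S leSn *.
have deg_sub (T U : {set G}) : T \subset U ->
    {in U, forall v, degree_in U v <= 2}%N ->
  {in T, forall v, degree_in T v <= 2}%N.
  move=> TU deg2 v vT; apply: leq_trans (degree_in_subset v TU) (deg2 v _).
  exact: (subsetP TU).
have [/existsP[v0 /andP[v0S v0_3]]|] :=
    boolP [exists v, (v \in S) && (3 <= degree_in S v)%N].
  (* Some degree is at least 3: delete a vertex of maximum degree. *)
  case: (@arg_maxnP _ v0 (fun v => v \in S) (degree_in S) v0S) => x xS max_x.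
  have [|T [TS acT degT wT]] := IHn (S :\ x).
    by move: leSn; rewrite (cardsD1 x S) xS.
  exists T; split=> //; first exact: subset_trans TS (subsetDl _ _).
  apply: le_trans wT; apply: weight_delete_max => //.
  exact: leq_trans v0_3 (max_x v0 v0S).
rewrite negb_exists => /forallP deg_lt3.
have deg2 : {in S, forall v, degree_in S v <= 2}%N.
  by move=> v vS; have := deg_lt3 v; rewrite vS /= -ltnNge.
have [[c [cS szc cyc]]|no_c] := EM (exists c : seq G,
  [/\ {subset c <= S}, (3 <= size c)%N & ucycle (@adj G) c]); last first.
  exists S; split=> //; last first.
    by rewrite -sumr_const; apply: ler_sum => v _; apply: f_leq1.
  by move=> c cS szc cyc; apply: no_c; exists c.
(* Remove the whole cycle, then put back all its vertices but [x]. *)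
have /hasP[x xc _] : has predT c by rewrite has_predT; apply: leq_trans szc.
have Uc : uniq c by case/andP: cyc.
have cardC : #|[set v in c]| = size c by rewrite cardsE (card_uniqP Uc).
have CS : [set v in c] \subset S by apply/subsetP => v; rewrite inE => /cS.
have [|T [TS acT degT wT]] := IHn (S :\: [set v in c]).
  have := subset_leq_card CS; rewrite cardsD (setIidPr CS) cardC; lia.
have T'S : T :|: ([set v in c] :\ x) \subset S.
  rewrite subUset (subset_trans TS (subsetDl _ _)).
  exact: subset_trans (subsetDl _ _) CS.
exists (T :|: ([set v in c] :\ x)); split=> //.
- exact: acyclic_break_cycle TS acT.
- exact: deg_sub T'S deg2.
apply: le_trans (weight_delete_cycle deg2 cyc szc cS) _.
have -> : #|T :|: ([set v in c] :\ x)| = (#|T| + (size c).-1)%N.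
  rewrite cardsU -cardC [#|[set v in c]|](cardsD1 x) inE xc /=.
  suff -> : T :&: ([set v in c] :\ x) = set0 by rewrite cards0 subn0.
  apply/eqP; rewrite setI_eq0 disjoints_subset; apply/subsetP => w.
  by move/(subsetP TS); rewrite !inE => /andP[/negbTE-> _]; rewrite andbF.
by rewrite natrD lerD2r.
Qed.

End Weight.

Theorem theorem4 (R : realType) (G : sgraph) :
  exists S : {set G},
    is_linear_forest (induced S) /\
    \sum_(v : G) f R (degree v) <= #|S|%:R.
Proof.
have [T [_ acT degT wT]] := large_linear_forest_set R [set: G].
exists T; split; first exact: induced_linear_forest.
suff -> : \sum_(v : G) f R (degree v) = weight R [set: G] by [].
by apply: eq_big => v; rewrite ?inE // degree_in_setT.
Qed.
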